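(* Let $d\ge1$ and $n\ge3$ be integers. In ${\rm YTL}_{d,n}(u)$ set $l_i:=\frac{1}{u+1}(g_i+1)$ for $1\le i\le n-1$. Then ${\rm YTL}_{d,n}(u)$ can be presented as the $K$-algebra generated by $1,l_1,\dots,l_{n-1},t_1,\dots,t_n$ with the following defining relations (for all indices for which they make sense): $$t_i^d=1\ \text{ for all } i;$$ $$t_it_j=t_jt_i\ \text{ for all } i,j;$$ $$l_it_j=t_jl_i\ \text{ for } j\ne i \text{ and } j\neq i+1;$$ $$l_it_i=t_{i+1}l_i+\frac{1}{u+1}(t_i-t_{i+1});$$ $$l_it_{i+1}=t_il_i+\frac{1}{u+1}(t_{i+1}-t_i);$$ $$l_i^2=\frac{(u-1)e_i+2}{u+1}\,l_i;$$ $$l_il_j=l_jl_i\ \text{ for } |i-j|>1;$$ $$l_il_{i\pm1}l_i=\frac{(u-1)e_i+1}{(u+1)^2}\,l_i,$$ where $e_i:=\frac1d\sum_{s=0}^{d-1}t_i^st_{i+1}^{-s}$.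
   Context: Let $u$ be an indeterminate and $K=\mathbb{C}(u)$; algebras are associative unital $K$-algebras. The Yokonuma--Hecke algebra ${\rm Y}_{d,n}(u)$ is the $K$-algebra generated by $g_1,\dots,g_{n-1},t_1,\dots,t_n$ subject to: $g_ig_j=g_jg_i$ for $|i-j|>1$; $g_{i+1}g_ig_{i+1}=g_ig_{i+1}g_i$; $g_i^2=1+(u-1)e_i+(u-1)e_ig_i$; $t_it_j=t_jt_i$ for all $i,j$; $t_i^d=1$; $g_it_i=t_{i+1}g_i$; $g_it_{i+1}=t_ig_i$; $g_it_j=t_jg_i$ for $j\ne i,i+1$; where $e_i:=\frac1d\sum_{s=0}^{d-1}t_i^st_{i+1}^{-s}$. For $|i-j|=1$ put $g_{i,j}:=1+g_i+g_j+g_ig_j+g_jg_i+g_ig_jg_i$. For $n\ge3$, the Yokonuma--Temperley--Lieb algebra is ${\rm YTL}_{d,n}(u):={\rm Y}_{d,n}(u)/I$, where $I$ is the two-sided ideal generated by all $g_{i,j}$ with $|i-j|=1$. The images of $g_i,t_j$ in the quotient are denoted by the same symbols. *)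

(* Defs.v *)
From HB Require Import structures.
From mathcomp Require Import all_boot all_order all_algebra.
From mathcomp.classical Require Import boolp.
From mathcomp.reals Require Import reals.
From mathcomp.real_closed Require Import complex.
From mathcomp.finmap Require finmap.
From mathcomp.multinomials Require Import monalg.

Set Implicit Arguments.
Unset Strict Implicit.
Unset Printing Implicit Defensive.

Import GRing.Theory IntDist.
Local Open Scope ring_scope.
Local Open Scope quotient_scope.

Inductive two_sided_ideal (K : fieldType) (A : algType K) (S : A -> Prop) :
    A -> Prop :=
  | ideal_gen x : S x -> two_sided_ideal S x
  | ideal0 : two_sided_ideal S 0
  | idealB x y :
      two_sided_ideal S x -> two_sided_ideal S y -> two_sided_ideal S (x - y)
  | idealMl a x : two_sided_ideal S x -> two_sided_ideal S (a * x)
  | idealMr a x : two_sided_ideal S x -> two_sided_ideal S (x * a).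

(* algType excludes the zero ring, so only quotients by proper ideals carry the
   structure. *)
Record proper_gens (K : fieldType) (A : algType K) := ProperGens {
  gens_of :> A -> Prop;
  _ : ~ two_sided_ideal gens_of 1
}.

Section QuotientAlgebra.
Context (K : fieldType) (A : algType K) (S : proper_gens A).

Definition in_ideal : pred A := fun x => `[< two_sided_ideal S x >].

Fact in_ideal_zmod_closed : zmod_closed in_ideal.
Proof.
split=> [|x y /asboolP Ix /asboolP Iy]; apply/asboolP; first exact: ideal0.
exact: idealB.
Qed.
HB.instance Definition _ :=
  GRing.isZmodClosed.Build A in_ideal in_ideal_zmod_closed.

Definition ideal_closed : zmodClosed A := GRing.ZmodClosed.clone A in_ideal _.

Definition quot_alg : Type := ring_quotient.Quotient.quot ideal_closed.
HB.instance Definition _ := GRing.Zmodule.on quot_alg.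
HB.instance Definition _ := EqQuotient.on quot_alg.

Definition quot_proj (x : A) : quot_alg := \pi_quot_alg x.

Lemma quot_projP x y :
  quot_proj x = quot_proj y <-> two_sided_ideal S (x - y).
Proof.
rewrite /quot_proj; split=> [/eqP|Ixy].
  by rewrite -ring_quotient.Quotient.idealrBE => /asboolP.
by apply/eqP; rewrite -ring_quotient.Quotient.idealrBE; apply/asboolP.
Qed.

Lemma quot_reprK (q : quot_alg) : quot_proj (repr q) = q.
Proof. exact: reprK. Qed.

Lemma quot_projB x y : quot_proj (x - y) = quot_proj x - quot_proj y.
Proof. exact: (raddfB (\pi_(ring_quotient.Quotient.quot ideal_closed))). Qed.

Lemma quot_projD x y : quot_proj (x + y) = quot_proj x + quot_proj y.
Proof. exact: (raddfD (\pi_(ring_quotient.Quotient.quot ideal_closed))). Qed.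

Definition quot_one : quot_alg := quot_proj 1.
Definition quot_mul (p q : quot_alg) : quot_alg := quot_proj (repr p * repr q).
Definition quot_scale (k : K) (q : quot_alg) : quot_alg :=
  quot_proj (k *: repr q).

Lemma quot_projM x y : quot_proj (x * y) = quot_mul (quot_proj x) (quot_proj y).
Proof.
apply/quot_projP; set x' := repr _; set y' := repr _.
have Ix : two_sided_ideal S (x - x') by apply/quot_projP; rewrite quot_reprK.
have Iy : two_sided_ideal S (y - y') by apply/quot_projP; rewrite quot_reprK.
have -> : x * y - x' * y' = (x - x') * y - (0 - x' * (y - y')).
  by rewrite sub0r opprK mulrBl mulrBr addrA subrK.
apply: idealB; first exact: idealMr.
by apply: idealB; [exact: ideal0|exact: idealMl].
Qed.

Lemma quot_projZ k x : quot_proj (k *: x) = quot_scale k (quot_proj x).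
Proof.
apply/quot_projP; rewrite -scalerBr -mulr_algl; apply: idealMl.
by apply/quot_projP; rewrite quot_reprK.
Qed.

Fact quot_mulA : associative quot_mul.
Proof.
move=> p q r; rewrite -[p]quot_reprK -[q]quot_reprK -[r]quot_reprK.
by rewrite -!quot_projM mulrA.
Qed.

Fact quot_mul1q : left_id quot_one quot_mul.
Proof. by move=> p; rewrite -[p]quot_reprK -quot_projM mul1r. Qed.

Fact quot_mulq1 : right_id quot_one quot_mul.
Proof. by move=> p; rewrite -[p]quot_reprK -quot_projM mulr1. Qed.

Fact quot_mulDl : left_distributive quot_mul +%R.
Proof.
move=> p q r; rewrite -[p]quot_reprK -[q]quot_reprK -[r]quot_reprK.
by rewrite -quot_projD -!quot_projM -quot_projD mulrDl.
Qed.

Fact quot_mulDr : right_distributive quot_mul +%R.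
Proof.
move=> p q r; rewrite -[p]quot_reprK -[q]quot_reprK -[r]quot_reprK.
by rewrite -quot_projD -!quot_projM -quot_projD mulrDr.
Qed.

Fact quot_one_neq0 : quot_one != 0.
Proof.
apply/eqP; rewrite -(subrr (quot_proj 0)) -quot_projB => /quot_projP.
by rewrite !subr0; case: (S).
Qed.

HB.instance Definition _ := GRing.Zmodule_isNzRing.Build quot_alg
  quot_mulA quot_mul1q quot_mulq1 quot_mulDl quot_mulDr quot_one_neq0.

Fact quot_scaleA a b (q : quot_alg) :
  quot_scale a (quot_scale b q) = quot_scale (a * b) q.
Proof. by rewrite -[q]quot_reprK -!quot_projZ scalerA. Qed.

Fact quot_scale1 : left_id 1 quot_scale.
Proof. by move=> q; rewrite -[q]quot_reprK -quot_projZ scale1r. Qed.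

Fact quot_scaleDr : right_distributive quot_scale +%R.
Proof.
move=> a p q; rewrite -[p]quot_reprK -[q]quot_reprK.
by rewrite -quot_projD -!quot_projZ -quot_projD scalerDr.
Qed.

Fact quot_scaleDl (q : quot_alg) : {morph quot_scale^~ q : a b / a + b}.
Proof.
by move=> a b; rewrite -[q]quot_reprK -!quot_projZ -quot_projD scalerDl.
Qed.

HB.instance Definition _ := GRing.Zmodule_isLmodule.Build K quot_alg
  quot_scaleA quot_scale1 quot_scaleDr quot_scaleDl.

Fact quot_scaleAl a (p q : quot_alg) : a *: (p * q) = (a *: p) * q.
Proof.
rewrite -[p]quot_reprK -[q]quot_reprK.
have mulE x y : quot_proj x * quot_proj y = quot_proj (x * y).
  by rewrite quot_projM.
have scaleE x : a *: quot_proj x = quot_proj (a *: x) by rewrite quot_projZ.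
by rewrite mulE !scaleE mulE scalerAl.
Qed.

HB.instance Definition _ :=
  GRing.Lmodule_isLalgebra.Build K quot_alg quot_scaleAl.

Fact quot_scaleAr a (p q : quot_alg) : a *: (p * q) = p * (a *: q).
Proof.
rewrite -[p]quot_reprK -[q]quot_reprK.
have mulE x y : quot_proj x * quot_proj y = quot_proj (x * y).
  by rewrite quot_projM.
have scaleE x : a *: quot_proj x = quot_proj (a *: x) by rewrite quot_projZ.
by rewrite mulE !scaleE mulE scalerAr.
Qed.

HB.instance Definition _ :=
  GRing.Lalgebra_isAlgebra.Build K quot_alg quot_scaleAr.

Fact quot_proj_is_zmod_morphism : zmod_morphism quot_proj.
Proof. exact: quot_projB. Qed.
HB.instance Definition _ := GRing.isZmodMorphism.Build A quot_alg quot_proj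
  quot_proj_is_zmod_morphism.

Fact quot_proj_is_monoid_morphism : monoid_morphism quot_proj.
Proof. by split=> // x y; rewrite quot_projM. Qed.
HB.instance Definition _ := GRing.isMonoidMorphism.Build A quot_alg quot_proj
  quot_proj_is_monoid_morphism.

Fact quot_proj_is_scalable : scalable quot_proj.
Proof. by move=> k x; rewrite quot_projZ. Qed.
HB.instance Definition _ := GRing.isScalable.Build K A quot_alg *:%R quot_proj
  quot_proj_is_scalable.

End QuotientAlgebra.

Arguments quot_proj {K A} S x.

Section Characters.
Context (K : fieldType) (A : algType K) (C : nzRingType).
Context (chi : {rmorphism A -> C}).

Lemma character_ideal (S : A -> Prop) (chiS : forall x, S x -> chi x = 0) x :
  two_sided_ideal S x -> chi x = 0.
Proof.
elim=> {x} [x /chiS//||x y _ hx _ hy|a x _ hx|a x _ hx]; first exact: rmorph0.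
- by rewrite rmorphB hx hy subr0.
- by rewrite rmorphM hx mulr0.
- by rewrite rmorphM hx mul0r.
Qed.

Lemma character_proper (S : A -> Prop) (chiS : forall x, S x -> chi x = 0) :
  ~ two_sided_ideal S 1.
Proof.
by move=> /(character_ideal chiS)/eqP; rewrite rmorph1 oner_eq0.
Qed.

Context (S : proper_gens A).
Hypothesis chiS : forall x, S x -> chi x = 0.

Definition quot_character (q : quot_alg S) : C := chi (repr q).

Lemma quot_characterE x : quot_character (quot_proj S x) = chi x.
Proof.
apply/eqP; rewrite -subr_eq0 -rmorphB; apply/eqP/(character_ideal chiS).
by apply/quot_projP; rewrite quot_reprK.
Qed.

Fact quot_character_zmod_morphism : zmod_morphism quot_character.
Proof.
move=> p q; rewrite -[p]quot_reprK -[q]quot_reprK -quot_projB.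
by rewrite !quot_characterE rmorphB.
Qed.

Fact quot_character_monoid_morphism : monoid_morphism quot_character.
Proof.
split=> [|p q]; first by rewrite (quot_characterE 1) rmorph1.
rewrite -[p]quot_reprK -[q]quot_reprK -(rmorphM (quot_proj S)).
by rewrite !quot_characterE rmorphM.
Qed.

Definition quot_character_rmorphism : {rmorphism quot_alg S -> C} :=
  HB.pack quot_character
    (GRing.isZmodMorphism.Build (quot_alg S) C quot_character
       quot_character_zmod_morphism)
    (GRing.isMonoidMorphism.Build (quot_alg S) C quot_character
       quot_character_monoid_morphism).

End Characters.

Fact malg_scaleAr (K : fieldType) (M : monomType) k (p q : {malg K[M]}) :
  k *: (p * q) = p * (k *: q).
Proof.
apply/malgP => m; rewrite mcoeffZ mcoeffMl.
rewrite (mcoeffMlw m (finmap.fsubset_refl _) (msuppZ_le k q)) mulr_sumr.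
apply: eq_bigr => i _; rewrite mulr_sumr; apply: eq_bigr => j _.
by rewrite mcoeffZ mulrnAr mulrCA.
Qed.

Section FreeAlgebra.
Context (K : fieldType) (X : choiceType).

Definition free_alg : Type := {malg K[{fmonom X}]}.
HB.instance Definition _ := GRing.Lalgebra.on free_alg.
HB.instance Definition _ := GRing.Lalgebra_isAlgebra.Build K free_alg
  (@malg_scaleAr K {fmonom X}).

Definition free_gen (x : X) : free_alg := << fmu x >>.

Context (A : algType K) (a : X -> A).

Definition eval_monom (m : {fmonom X}) : A := \prod_(x <- (m : seq X)) a x.

Definition eval_free (p : free_alg) : A := mmap (GRing.in_alg A) eval_monom p.

Fact eval_monom_mmorphism : mmorphism eval_monom.
Proof.
by split=> [m1 m2|]; rewrite /eval_monom ?fmM ?fm1 ?big_cat ?big_nil.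
Qed.
HB.instance Definition _ :=
  isMultiplicative.Build {fmonom X} A eval_monom eval_monom_mmorphism.

Fact eval_free_zmod_morphism : zmod_morphism eval_free.
Proof. exact: mmapB. Qed.
HB.instance Definition _ := GRing.isZmodMorphism.Build free_alg A eval_free
  eval_free_zmod_morphism.

Fact eval_free_monoid_morphism : monoid_morphism eval_free.
Proof.
have comm_in_alg (g : {malg K[{fmonom X}]}) (m m' : {fmonom X}) :
    GRing.comm (GRing.in_alg A g@_m) (eval_monom m').
  exact: GRing.comm_alg.
have [evalM eval1] := commr_mmap_is_multiplicative comm_in_alg.
by split.
Qed.
HB.instance Definition _ := GRing.isMonoidMorphism.Build free_alg A eval_free
  eval_free_monoid_morphism.

Fact eval_free_is_scalable : scalable eval_free.
Proof.
by move=> k p; rewrite /eval_free mmapZ /= mulr_algl.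
Qed.
HB.instance Definition _ := GRing.isScalable.Build K free_alg A *:%R eval_free
  eval_free_is_scalable.

Lemma eval_free_gen x : eval_free (free_gen x) = a x.
Proof.
by rewrite /eval_free mmapU /= scale1r mul1r /eval_monom fmU big_seq1.
Qed.

End FreeAlgebra.

Arguments free_gen K {X} x.

Definition relators (A : zmodType) (rel : A -> A -> Prop) : A -> Prop :=
  fun z => exists x y, rel x y /\ z = x - y.

(* A is presented by the generators a_x subject to the relations rel: the
   canonical map from the free algebra to A is onto and its kernel is the
   two-sided ideal generated by the relators. *)
Definition presented_by (K : fieldType) (A : algType K) (X : choiceType)
    (a : X -> A) (rel : free_alg K X -> free_alg K X -> Prop) : Prop :=
  (forall y : A, exists p, eval_free a p = y) /\
  (forall p, eval_free a p = 0 <-> two_sided_ideal (relators rel) p).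

(* The indices 1, ..., n-1 of the g_i (or l_i) are shifted to 'I_n.-1, and the
   indices 1, ..., n of the t_j to 'I_n; lo i and hi i are the indices i and
   i + 1 of the t's. *)
Section Relations.
Context (n : nat).

Fact lo_proof (i : 'I_n.-1) : (i < n)%N.
Proof. exact: leq_trans (ltn_ord i) (leq_pred n). Qed.
Fact hi_proof (i : 'I_n.-1) : (i.+1 < n)%N.
Proof. by rewrite -ltn_predRL. Qed.

Definition lo (i : 'I_n.-1) : 'I_n := Ordinal (lo_proof i).
Definition hi (i : 'I_n.-1) : 'I_n := Ordinal (hi_proof i).

Context (K : fieldType) (u : K) (d : nat) (A : algType K).

(* t (hi i) ^+ (d - s) stands for t_{i+1}^(-s): A is to be a free algebra, where
   the t's have no inverses, but s < d and both presentations below impose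
   t_{i+1}^d = 1. *)
Definition idem (t : 'I_n -> A) (i : 'I_n.-1) : A :=
  d%:R^-1 *: \sum_(s < d) t (lo i) ^+ s * t (hi i) ^+ (d - s).

Inductive YH_rel (g : 'I_n.-1 -> A) (t : 'I_n -> A) : A -> A -> Prop :=
  | YH_gg_far (i j : 'I_n.-1) of (1 < `|i - j|)%N :
      YH_rel g t (g i * g j) (g j * g i)
  | YH_braid (i j : 'I_n.-1) of (j = i.+1 :> nat) :
      YH_rel g t (g j * g i * g j) (g i * g j * g i)
  | YH_quad i :
      YH_rel g t (g i ^+ 2)
        (1 + (u - 1) *: idem t i + (u - 1) *: (idem t i * g i))
  | YH_tt i j : YH_rel g t (t i * t j) (t j * t i)
  | YH_td i : YH_rel g t (t i ^+ d) 1
  | YH_gt_lo i : YH_rel g t (g i * t (lo i)) (t (hi i) * g i)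
  | YH_gt_hi i : YH_rel g t (g i * t (hi i)) (t (lo i) * g i)
  | YH_gt_far i j of j != lo i & j != hi i : YH_rel g t (g i * t j) (t j * g i).

Inductive YTL_rel (l : 'I_n.-1 -> A) (t : 'I_n -> A) : A -> A -> Prop :=
  | YTL_td i : YTL_rel l t (t i ^+ d) 1
  | YTL_tt i j : YTL_rel l t (t i * t j) (t j * t i)
  | YTL_lt_far i j of j != lo i & j != hi i : YTL_rel l t (l i * t j) (t j * l i)
  | YTL_lt_lo i :
      YTL_rel l t (l i * t (lo i))
        (t (hi i) * l i + (u + 1)^-1 *: (t (lo i) - t (hi i)))
  | YTL_lt_hi i :
      YTL_rel l t (l i * t (hi i))
        (t (lo i) * l i + (u + 1)^-1 *: (t (hi i) - t (lo i)))
  | YTL_quad i :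
      YTL_rel l t (l i ^+ 2)
        (((u + 1)^-1 *: ((u - 1) *: idem t i + 2%:R)) * l i)
  | YTL_ll_far (i j : 'I_n.-1) of (1 < `|i - j|)%N :
      YTL_rel l t (l i * l j) (l j * l i)
  | YTL_ll_adj (i j : 'I_n.-1) of (`|i - j| = 1)%N :
      YTL_rel l t (l i * l j * l i)
        (((u + 1) ^- 2 *: ((u - 1) *: idem t i + 1)) * l i).

(* The character g_i |-> -1, t_j |-> 1, shows that neither algebra is the zero
   ring. *)
Lemma sign_YH_rel (chi : {rmorphism A -> K^o}) g t x y :
    (forall i, chi (g i) = -1) -> (forall j, chi (t j) = 1) ->
  YH_rel g t x y -> chi x = chi y.
Proof.
move=> chig chit; case=> [i j _|i j _|i|i j|i|i|i|i j _ _].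
- by rewrite !rmorphM !chig.
- by rewrite !rmorphM !chig.
- have -> : 1 + (u - 1) *: idem t i + (u - 1) *: (idem t i * g i)
            = 1 + ((u - 1) *: idem t i) * (1 + g i).
    by rewrite (scalerAl _ (idem t i)) mulrDr mulr1 addrA.
  rewrite rmorphXn rmorphD rmorphM rmorphD rmorph1 chig.
  by rewrite subrr mulr0 addr0 sqrrN expr1n.
- by rewrite !rmorphM !chit.
- by rewrite rmorphXn chit expr1n rmorph1.
- by rewrite !rmorphM chig !chit mulrC.
- by rewrite !rmorphM chig !chit mulrC.
- by rewrite !rmorphM chig !chit mulrC.
Qed.

(* g_{i,j}, for x = g_i and y = g_j *)
Definition braid_sum (x y : A) : A :=
  1 + x + y + x * y + y * x + x * y * x.

Lemma sign_braid_sum (chi : {rmorphism A -> K^o}) x y :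
  chi x = -1 -> chi y = -1 -> chi (braid_sum x y) = 0.
Proof.
move=> chix chiy; rewrite !rmorphD !rmorphM rmorph1 chix chiy.
by rewrite mulrNN mulr1 mulrN1 subrr sub0r addrK addNr.
Qed.

End Relations.

Section Algebras.
Context (K : fieldType) (u : K) (d n : nat).

(* inl i stands for the i-th g in one presentation and for the i-th l in the
   other, inr j for the j-th t. *)
Definition letter : choiceType := ('I_n.-1 + 'I_n)%type.

Definition letter_g (i : 'I_n.-1) : free_alg K letter := free_gen K (inl i).
Definition letter_t (j : 'I_n) : free_alg K letter := free_gen K (inr j).

Definition sign_val (x : letter) : K^o := if x is inl _ then -1 else 1.

Definition sign_char : {rmorphism free_alg K letter -> K^o} :=
  eval_free sign_val.

Fact sign_char_YH x :
  relators (YH_rel u d letter_g letter_t) x -> sign_char x = 0.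
Proof.
case=> y [z [r ->]]; rewrite rmorphB; apply/eqP; rewrite subr_eq0; apply/eqP.
by apply: sign_YH_rel r => i; exact: eval_free_gen.
Qed.

Definition YH_gens : proper_gens (free_alg K letter) :=
  ProperGens (character_proper (chi := sign_char) sign_char_YH).

Definition YokonumaHecke : algType K := quot_alg YH_gens.

Definition YH_g (i : 'I_n.-1) : YokonumaHecke := quot_proj YH_gens (letter_g i).
Definition YH_t (j : 'I_n) : YokonumaHecke := quot_proj YH_gens (letter_t j).

Definition YTL_set (x : YokonumaHecke) : Prop :=
  exists i j : 'I_n.-1, (`|i - j| = 1)%N /\ x = braid_sum (YH_g i) (YH_g j).

Definition sign_YH_char : {rmorphism YokonumaHecke -> K^o} :=
  quot_character_rmorphism (S := YH_gens) sign_char_YH.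

Fact sign_YH_char_g i : sign_YH_char (YH_g i) = -1.
Proof.
exact: etrans (quot_characterE (S := YH_gens) sign_char_YH _)
              (eval_free_gen _ _).
Qed.

Fact sign_YH_char_YTL x : YTL_set x -> sign_YH_char x = 0.
Proof.
by move=> [i [j [_ ->]]]; apply: sign_braid_sum; exact: sign_YH_char_g.
Qed.

Definition YTL_gens : proper_gens YokonumaHecke :=
  ProperGens (character_proper (chi := sign_YH_char) sign_YH_char_YTL).

Definition YokonumaTL : algType K := quot_alg YTL_gens.

Definition YTL_g (i : 'I_n.-1) : YokonumaTL := quot_proj YTL_gens (YH_g i).
Definition YTL_t (j : 'I_n) : YokonumaTL := quot_proj YTL_gens (YH_t j).
Definition YTL_l (i : 'I_n.-1) : YokonumaTL := (u + 1)^-1 *: (YTL_g i + 1).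

Definition YTL_gen (x : letter) : YokonumaTL :=
  match x with inl i => YTL_l i | inr j => YTL_t j end.

End Algebras.

(* ratfun R is C(u), where C = R[i] and u = ratvar R. *)
Notation ratfun R := {fraction {poly R[i]}}.
Definition ratvar (R : realType) : ratfun R := tofrac 'X.

(* Main.v *)
Require Import Defs.
From mathcomp Require Import all_boot all_order all_algebra.
From mathcomp.reals Require Import reals.
From mathcomp.real_closed Require Import complex.
From mathcomp.multinomials Require Import monalg.

(** Both sides are quotients of free algebras on the same letters, so everything
reduces to one fact about elements of an arbitrary algebra: if
[(u + 1) l_i = g_i + 1] with [u + 1] invertible, then the [g_i], [t_j] satisfy
the Yokonuma--Hecke relations together with [g_{i,j} = 0] for adjacent [i], [j]
if and only if the [l_i], [t_j] satisfy the relations to be established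
([YTL_rel_of_YH], [YH_rel_of_YTL] and [braid_sum_of_YTL]).

Most relations correspond under the affine substitution one by one.  The link
between the two cubic relations is the expansion
[(g_i + 1) (g_j + 1) (g_i + 1) = g_{i,j} + g_i (g_i + 1)]
([mul3_addr1]) in which the quadratic relation gives
[g_i (g_i + 1) = (1 + (u - 1) e_i) (g_i + 1)] ([quad_addr1]).  Hence
[g_{i,j} = 0] is the relation for [l_i l_j l_i].  The braid relation is then
implied: [g_{i,j}] and [g_{j,i}] differ only by [g_i g_j g_i - g_j g_i g_j].

One implication says that evaluation at the [l_i], [t_j] kills the relators
([eval_YTL_gen_relator]).  For the converse inclusion of ideals
([eval_YTL_gen_eq0]), the other implication yields a morphism from the
Yokonuma--Hecke algebra to the algebra presented by the new relations that kills
the [g_{i,j}], hence the ideal that they generate.  It carries any lift of the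
value of [p] at the [l_i], [t_j] to the class of [p], as the substitutions
[l = (g + 1) / (u + 1)] and [g = (u + 1) l - 1] of the free
algebra are inverse to each other. *)

Set Implicit Arguments.
Unset Strict Implicit.
Unset Printing Implicit Defensive.

Import GRing.Theory IntDist.
Local Open Scope ring_scope.

(** * Change of generators in an arbitrary algebra *)

(** Adding [x] to both sides of the quadratic relation makes them multiples of
[x + 1]. *)
Lemma quad_addr1 (A : nzRingType) (x c : A) :
  (x ^+ 2 == 1 + c + c * x) = (x * (x + 1) == (c + 1) * (x + 1)).
Proof.
have -> : (c + 1) * (x + 1) = 1 + c + c * x + x.
  rewrite mulrDl mul1r mulrDr mulr1.
  by rewrite [LHS](AC (2*2) (4*2*1*3)).
by rewrite mulrDr mulr1 -expr2 (inj_eq (addIr x)).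
Qed.

(** Adding [x + 1] to both sides completes the square on the left. *)
Lemma sqr_addr1 (A : nzRingType) (x c : A) :
  (x * (x + 1) == (c + 1) * (x + 1)) =
  ((x + 1) * (x + 1) == (c + 2%:R) * (x + 1)).
Proof.
rewrite -(inj_eq (addIr (x + 1))) -[X in _ + X == _]mul1r -mulrDl.
by rewrite -[X in _ == _ + X]mul1r -mulrDl -addrA.
Qed.

Lemma mul3_addr1 (K : fieldType) (A : algType K) (x y : A) :
  (x + 1) * (y + 1) * (x + 1) = braid_sum x y + x * (x + 1).
Proof.
rewrite /braid_sum !(mulrDl, mulrDr, mulr1, mul1r) !addrA.
by rewrite [LHS](ACl (8*6*7*5*3*1*2*4)).
Qed.

Section AffineSubstitution.
Context (K : fieldType) (A : algType K) (w : K) (w_neq0 : w != 0).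
Implicit Types x y a b c : A.

(** The term [w *: (a - b)] is the defect of the shift by [1].  It vanishes when
[a = b], so that the relations between the [l_i] and the far [t_j] are instances
as well. *)
Lemma twist_addr1 x a b :
  ((w *: (x + 1)) * a == b * (w *: (x + 1)) + w *: (a - b)) = (x * a == b * x).
Proof.
rewrite -scalerAl -scalerAr -scalerDr (inj_eq (scalerI w_neq0)).
by rewrite mulrDl mulrDr mul1r mulr1 -addrA subrKC (inj_eq (addIr a)).
Qed.

Lemma comm_scale_addr1 x y :
  ((w *: (x + 1)) * (w *: (y + 1)) == (w *: (y + 1)) * (w *: (x + 1))) =
  (x * y == y * x).
Proof.
rewrite -!scalerAl -!scalerAr !(inj_eq (scalerI w_neq0)).
rewrite !mulrDl !mulrDr !mul1r !mulr1 !addrA !(inj_eq (addIr 1)).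
by rewrite -!addrA [x + y]addrC (inj_eq (addIr _)).
Qed.

Lemma quad_scale x c :
  ((w *: x) ^+ 2 == (w *: c) * (w *: x)) = (x * x == c * x).
Proof.
by rewrite expr2 -!scalerAl -!scalerAr !(inj_eq (scalerI w_neq0)).
Qed.

Lemma cubic_scale x y c :
  ((w *: x) * (w *: y) * (w *: x) == ((w ^+ 2) *: c) * (w *: x)) =
  (x * y * x == c * x).
Proof.
by rewrite -!(scalerAl, scalerAr) expr2 -scalerA !(inj_eq (scalerI w_neq0)).
Qed.

End AffineSubstitution.

Section ChangeOfGenerators.
Context (K : fieldType) (u : K) (u1_neq0 : u + 1 != 0) (d n : nat).
Context (A : algType K) (g l : 'I_n.-1 -> A) (t : 'I_n -> A).
Hypothesis lE : forall i, l i = (u + 1)^-1 *: (g i + 1).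

Let w_neq0 : (u + 1)^-1 != 0. Proof. by rewrite invr_eq0. Qed.

(** The summand [(1 + (u - 1) e_i) (g_i + 1)] in the expansion of
[(g_i + 1) (g_j + 1) (g_i + 1)] is the right-hand side of the cubic relation up
to the common factor [(u + 1) ^- 3], so that what is left is [g_{i,j}]. *)
Lemma cubic_braid_sum i j :
    g i ^+ 2 =
      1 + (u - 1) *: idem d t i + (u - 1) *: (idem d t i * g i) ->
  (l i * l j * l i == ((u + 1) ^- 2 *: ((u - 1) *: idem d t i + 1)) * l i) =
  (braid_sum (g i) (g j) == 0).
Proof.
rewrite scalerAl => /eqP; rewrite quad_addr1 => /eqP gi.
rewrite !lE -exprVn (cubic_scale w_neq0) mul3_addr1 gi.
by rewrite -[X in _ == X]add0r (inj_eq (addIr _)).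
Qed.

Lemma quad_change i :
  (l i ^+ 2 == ((u + 1)^-1 *: ((u - 1) *: idem d t i + 2%:R)) * l i) =
  (g i ^+ 2 == 1 + (u - 1) *: idem d t i + (u - 1) *: (idem d t i * g i)).
Proof. by rewrite lE (quad_scale w_neq0) -sqr_addr1 -quad_addr1 scalerAl. Qed.

Lemma YTL_rel_of_YH :
    (forall x y, YH_rel u d g t x y -> x = y) ->
    (forall i j : 'I_n.-1, (`|i - j| = 1)%N -> braid_sum (g i) (g j) = 0) ->
  forall x y, YTL_rel u d l t x y -> x = y.
Proof.
move=> YH gg0 x y.
case=> [i|i j|i j jlo jhi|i|i|i|i j ij|i j ij]; apply/eqP.
- by rewrite (YH _ _ (YH_td _ _ _ _ _)).
- by rewrite (YH _ _ (YH_tt _ _ _ _ _ _)).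
- rewrite -[X in _ == X]addr0 -(scaler0 _ (u + 1)^-1) -(subrr (t j)) lE.
  by rewrite (twist_addr1 w_neq0) (YH _ _ (YH_gt_far _ _ _ _ jlo jhi)).
- by rewrite lE (twist_addr1 w_neq0) (YH _ _ (YH_gt_lo _ _ _ _ _)).
- by rewrite lE (twist_addr1 w_neq0) (YH _ _ (YH_gt_hi _ _ _ _ _)).
- by rewrite quad_change; apply/eqP/YH/YH_quad.
- by rewrite !lE (comm_scale_addr1 w_neq0) (YH _ _ (YH_gg_far _ _ _ _ ij)).
- by rewrite cubic_braid_sum ?gg0 //; apply/YH/YH_quad.
Qed.

Hypothesis YTL : forall x y, YTL_rel u d l t x y -> x = y.

Lemma braid_sum_of_YTL (i j : 'I_n.-1) :
  (`|i - j| = 1)%N -> braid_sum (g i) (g j) = 0.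
Proof.
move=> ij; apply/eqP; rewrite -cubic_braid_sum.
  by apply/eqP/YTL/YTL_ll_adj.
by apply/eqP; rewrite -quad_change; apply/eqP/YTL/YTL_quad.
Qed.

Lemma YH_rel_of_YTL x y : YH_rel u d g t x y -> x = y.
Proof.
case=> [i j ij|i j ji|i|i j|i|i|i|i j jlo jhi]; apply/eqP.
- by rewrite -(comm_scale_addr1 w_neq0) -!lE (YTL (YTL_ll_far _ _ _ _ ij)).
- have ij : (`|i - j| = 1)%N by rewrite ji distnS.
  have gji0 : braid_sum (g j) (g i) = 0.
    by apply: braid_sum_of_YTL; rewrite distnC.
  have := etrans gji0 (esym (braid_sum_of_YTL ij)); rewrite /braid_sum.
  (* All the terms but the last are symmetric in [g i] and [g j]. *)
  by rewrite [X in X + _ = _](ACl (1*3*2*5*4)) => /addrI ->.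
- by rewrite -quad_change; apply/eqP/YTL/YTL_quad.
- by rewrite (YTL (YTL_tt _ _ _ _ _ _)).
- by rewrite (YTL (YTL_td _ _ _ _ _)).
- by rewrite -(twist_addr1 w_neq0) -lE (YTL (YTL_lt_lo _ _ _ _ _)).
- by rewrite -(twist_addr1 w_neq0) -lE (YTL (YTL_lt_hi _ _ _ _ _)).
- rewrite -(twist_addr1 w_neq0) subrr scaler0 addr0 -lE.
  by rewrite (YTL (YTL_lt_far _ _ _ _ jlo jhi)).
Qed.

End ChangeOfGenerators.

(** * Morphisms out of the free algebra *)

Section FreeAlgebraMorphisms.
Context (K : fieldType) (X : choiceType).

Lemma monomial_prod (m : {fmonom X}) :
  (<< m >> : free_alg K X) = \prod_(x <- (m : seq X)) free_gen K x.
Proof.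
have mulU (m1 m2 : {fmonom X}) :
    (<< mmul m1 m2 >> : free_alg K X) = << m1 >> * << m2 >>.
  by rewrite malgM_def fgmulUU mulr1.
have fm_nil : FMonom [::] = mone :> {fmonom X}.
  by apply: val_inj; rewrite /= fm1.
case: m => s /=; elim: s => [|x s IHs]; first by rewrite big_nil fm_nil.
rewrite big_cons -IHs -mulU; congr << _ >>.
by apply: val_inj; rewrite /= fmM fmU.
Qed.

Context (A : algType K).

(** The uniqueness half of the universal property of the free algebra. *)
Lemma free_alg_morph (f : {lrmorphism free_alg K X -> A}) a p :
  (forall x, f (free_gen K x) = a x) -> f p = eval_free a p.
Proof.
move=> fa; rewrite /eval_free mmapE {1}[p]monalgE raddf_sum.
apply: eq_bigr => m _ /=.
have -> : << p@_m *g m >> = p@_m *: (<< m >> : free_alg K X).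
  by apply/malgP => k; rewrite mcoeffZ !mcoeffU mulr_natr.
rewrite linearZ /= mulr_algl monomial_prod rmorph_prod /eval_monom.
by congr (_ *: _); apply: eq_bigr => x _; exact: fa.
Qed.

Lemma free_alg_morph_comp (B : algType K) (f : {lrmorphism B -> A})
    (g : {lrmorphism free_alg K X -> B}) a p :
  (forall x, f (g (free_gen K x)) = a x) -> f (g p) = eval_free a p.
Proof. exact: (free_alg_morph (f := f \o g)). Qed.

End FreeAlgebraMorphisms.

Lemma free_alg_morph_id (K : fieldType) (X : choiceType)
    (f g : {lrmorphism free_alg K X -> free_alg K X}) p :
  (forall x, f (g (free_gen K x)) = free_gen K x) -> f (g p) = p.
Proof.
move=> fgE; rewrite (free_alg_morph_comp p fgE).
by rewrite -(free_alg_morph (f := idfun) p).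
Qed.

(** * Images of the relations under a morphism *)

Section RelationTransport.
Context (K : fieldType) (u : K) (d n : nat) (A B : algType K).
Context (f : {lrmorphism A -> B}).
Context (g : 'I_n.-1 -> A) (t : 'I_n -> A) (g' : 'I_n.-1 -> B) (t' : 'I_n -> B).
Hypothesis fg : forall i, f (g i) = g' i.
Hypothesis ft : forall j, f (t j) = t' j.

Lemma rmorph_idem i : f (idem d t i) = idem d t' i.
Proof.
rewrite /idem linearZ raddf_sum; congr (_ *: _); apply: eq_bigr => s _ /=.
by rewrite rmorphM !rmorphXn /= !ft.
Qed.

Lemma rmorph_braid_sum x y : f (braid_sum x y) = braid_sum (f x) (f y).
Proof. by rewrite !(rmorphD, rmorphM, rmorph1). Qed.

Lemma rmorph_YH_quad i :
  f (1 + (u - 1) *: idem d t i + (u - 1) *: (idem d t i * g i))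
  = 1 + (u - 1) *: idem d t' i + (u - 1) *: (idem d t' i * g' i).
Proof.
(* Generalized because [idem] unfolds to a scaled sum, which [linearZ] matches. *)
move: (idem d t i) (idem d t' i) (rmorph_idem i) => e e' fe.
by rewrite !rmorphD rmorph1 /= !linearZ /= rmorphM /= fe fg.
Qed.

Lemma rmorph_YTL_rhs (k c : K) i m :
  f ((k *: (c *: idem d t i + m%:R)) * g i)
  = (k *: (c *: idem d t' i + m%:R)) * g' i.
Proof.
move: (idem d t i) (idem d t' i) (rmorph_idem i) => e e' fe.
by rewrite rmorphM /= linearZ /= rmorphD /= linearZ /= rmorph_nat /= fe fg.
Qed.

Lemma rmorph_lt i j j' j'' k :
  f (t j * g i + k *: (t j' - t j'')) = t' j * g' i + k *: (t' j' - t' j'').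
Proof.
by rewrite rmorphD /= linearZ /= rmorphM rmorphB /= fg !ft.
Qed.

(** Each relation is natural in the algebra: its instance for the images [g'],
[t'] is the image of its instance for [g], [t].  Hence the images satisfy the
relations exactly when [f] identifies the two sides of each relation.  With a
free algebra as the source, this passes between relations in a quotient and
relators in the ideal. *)
Lemma YH_rel_image :
  (forall x y, YH_rel u d g' t' x y -> x = y) <->
  (forall x y, YH_rel u d g t x y -> f x = f y).
Proof.
split=> YH x y; case=> [i j ij|i j ji|i|i j|i|i|i|i j jlo jhi].
- by rewrite !rmorphM /= !fg; exact/YH/YH_gg_far.
- by rewrite !rmorphM /= !fg; exact/YH/YH_braid.
- by rewrite rmorph_YH_quad rmorphXn /= fg; exact/YH/YH_quad.
- by rewrite !rmorphM /= !ft; exact/YH/YH_tt.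
- by rewrite rmorphXn rmorph1 /= ft; exact/YH/YH_td.
- by rewrite !rmorphM /= fg !ft; exact/YH/YH_gt_lo.
- by rewrite !rmorphM /= fg !ft; exact/YH/YH_gt_hi.
- by rewrite !rmorphM /= fg ft; exact/YH/YH_gt_far.
- by have := YH _ _ (YH_gg_far u d g t ij); rewrite !rmorphM /= !fg.
- by have := YH _ _ (YH_braid u d g t ji); rewrite !rmorphM /= !fg.
- by have := YH _ _ (YH_quad u d g t i); rewrite rmorph_YH_quad rmorphXn /= fg.
- by have := YH _ _ (YH_tt u d g t i j); rewrite !rmorphM /= !ft.
- by have := YH _ _ (YH_td u d g t i); rewrite rmorphXn rmorph1 /= ft.
- by have := YH _ _ (YH_gt_lo u d g t i); rewrite !rmorphM /= fg !ft.
- by have := YH _ _ (YH_gt_hi u d g t i); rewrite !rmorphM /= fg !ft.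
- by have := YH _ _ (YH_gt_far u d g t jlo jhi); rewrite !rmorphM /= fg ft.
Qed.

Lemma YTL_rel_image :
  (forall x y, YTL_rel u d g' t' x y -> x = y) <->
  (forall x y, YTL_rel u d g t x y -> f x = f y).
Proof.
split=> YTL x y; case=> [i|i j|i j jlo jhi|i|i|i|i j ij|i j ij].
- by rewrite rmorphXn rmorph1 /= ft; exact/YTL/YTL_td.
- by rewrite !rmorphM /= !ft; exact/YTL/YTL_tt.
- by rewrite !rmorphM /= fg ft; exact/YTL/YTL_lt_far.
- by rewrite rmorph_lt rmorphM /= fg ft; exact/YTL/YTL_lt_lo.
- by rewrite rmorph_lt rmorphM /= fg ft; exact/YTL/YTL_lt_hi.
- by rewrite rmorph_YTL_rhs rmorphXn /= fg; exact/YTL/YTL_quad.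
- by rewrite !rmorphM /= !fg; exact/YTL/YTL_ll_far.
- by rewrite (rmorph_YTL_rhs _ _ _ 1) !rmorphM /= !fg; exact/YTL/YTL_ll_adj.
- by have := YTL _ _ (YTL_td u d g t i); rewrite rmorphXn rmorph1 /= ft.
- by have := YTL _ _ (YTL_tt u d g t i j); rewrite !rmorphM /= !ft.
- by have := YTL _ _ (YTL_lt_far u d g t jlo jhi); rewrite !rmorphM /= fg ft.
- by have := YTL _ _ (YTL_lt_lo u d g t i); rewrite rmorph_lt rmorphM /= fg ft.
- by have := YTL _ _ (YTL_lt_hi u d g t i); rewrite rmorph_lt rmorphM /= fg ft.
- have := YTL _ _ (YTL_quad u d g t i).
  by rewrite rmorph_YTL_rhs rmorphXn /= fg.
- by have := YTL _ _ (YTL_ll_far u d g t ij); rewrite !rmorphM /= !fg.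
- have := YTL _ _ (YTL_ll_adj u d g t ij).
  by rewrite (rmorph_YTL_rhs _ _ _ 1) !rmorphM /= !fg.
Qed.

End RelationTransport.

(** * The presentation of the Yokonuma--Temperley--Lieb algebra *)

Lemma quot_proj_relator (K : fieldType) (A : algType K) (S : proper_gens A)
    (rel : A -> A -> Prop) x y :
  (forall z, relators rel z -> S z) -> rel x y ->
  quot_proj S x = quot_proj S y.
Proof.
by move=> relS rxy; apply/quot_projP/ideal_gen/relS; exists x, y.
Qed.

Section Presentation.
Context (K : fieldType) (u : K) (u1_neq0 : u + 1 != 0) (d n : nat).

Local Notation F := (free_alg K (letter n)).
Local Notation g_ := (@letter_g K n).
Local Notation t_ := (@letter_t K n).
Local Notation YTL_gen := (@YTL_gen K u d n).

(** The substitutions [g = (u + 1) l - 1] and [l = (g + 1) / (u + 1)]: the letter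
[inl i] is read as [l_i] in the values of [g_to_l] and as [g_i] in its
arguments, and the other way round for [l_to_g].  They are known by their values
on the letters only, since this determines them. *)
Context (g_to_l l_to_g : {lrmorphism F -> F}).
Hypothesis g_to_l_g : forall i, g_to_l (g_ i) = (u + 1) *: g_ i - 1.
Hypothesis g_to_l_t : forall j, g_to_l (t_ j) = t_ j.
Hypothesis l_to_g_g : forall i, l_to_g (g_ i) = (u + 1)^-1 *: (g_ i + 1).
Hypothesis l_to_g_t : forall j, l_to_g (t_ j) = t_ j.

Lemma l_to_gK : cancel l_to_g g_to_l.
Proof.
move=> p; apply: free_alg_morph_id => -[i|j].
  rewrite l_to_g_g linearZ rmorphD /= rmorph1 g_to_l_g subrK.
  by rewrite scalerA mulVf // scale1r.
by rewrite l_to_g_t g_to_l_t.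
Qed.

Lemma g_to_lK : cancel g_to_l l_to_g.
Proof.
move=> p; apply: free_alg_morph_id => -[i|j].
  rewrite g_to_l_g rmorphB /= linearZ /= rmorph1 l_to_g_g.
  by rewrite scalerA mulfV // scale1r addrK.
by rewrite g_to_l_t l_to_g_t.
Qed.

Definition YTL_proj : {lrmorphism F -> YokonumaTL u d n} :=
  quot_proj (YTL_gens u d n) \o quot_proj (YH_gens u d n).

Lemma eval_YTL_genE p : eval_free YTL_gen p = YTL_proj (l_to_g p).
Proof.
apply/esym/free_alg_morph_comp => -[i|j].
  by rewrite [l_to_g _]l_to_g_g linearZ rmorphD rmorph1.
by rewrite [l_to_g _]l_to_g_t.
Qed.

Lemma eval_YTL_gen_surj (y : YokonumaTL u d n) :
  exists p, eval_free YTL_gen p = y.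
Proof.
exists (g_to_l (repr (repr y : YokonumaHecke u d n))).
by rewrite eval_YTL_genE g_to_lK /= !quot_reprK.
Qed.

Lemma YH_rel_YTL x y :
  YH_rel u d (@YTL_g K u d n) (@YTL_t K u d n) x y -> x = y.
Proof.
have projg i : YTL_proj (g_ i) = YTL_g u d i by [].
have projt j : YTL_proj (t_ j) = YTL_t u d j by [].
apply: (iffRL (YH_rel_image u d projg projt)) => {}x {}y xy.
by congr (quot_proj _ _); exact: quot_proj_relator xy.
Qed.

Lemma braid_sum_YTL (i j : 'I_n.-1) :
  (`|i - j| = 1)%N -> braid_sum (@YTL_g K u d n i) (YTL_g u d j) = 0.
Proof.
move=> ij; rewrite -rmorph_braid_sum -(rmorph0 (quot_proj (YTL_gens u d n))).
by apply/quot_projP; rewrite subr0; apply: ideal_gen; exists i, j.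
Qed.

Lemma eval_YTL_gen_relator z :
  relators (YTL_rel u d g_ t_) z -> eval_free YTL_gen z = 0.
Proof.
move=> [x [y [xy ->]]]; rewrite rmorphB; apply/eqP; rewrite subr_eq0; apply/eqP.
have evall i : eval_free YTL_gen (g_ i) = YTL_l u d i by exact: eval_free_gen.
have evalt j : eval_free YTL_gen (t_ j) = YTL_t u d j by exact: eval_free_gen.
apply: (iffLR (YTL_rel_image u d evall evalt)) xy.
exact: YTL_rel_of_YH YH_rel_YTL braid_sum_YTL.
Qed.

(** The algebra presented by the relations for the [l_i] is nonzero because it
maps to the Yokonuma--Temperley--Lieb algebra. *)
Definition presented_gens : proper_gens F :=
  ProperGens (character_proper (chi := eval_free YTL_gen) eval_YTL_gen_relator).

Definition presented_proj : {lrmorphism F -> quot_alg presented_gens} :=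
  quot_proj presented_gens.

Definition presented_g (i : 'I_n.-1) := presented_proj (g_to_l (g_ i)).
Definition presented_t (j : 'I_n) := presented_proj (t_ j).

Lemma presented_lE i :
  presented_proj (g_ i) = (u + 1)^-1 *: (presented_g i + 1).
Proof.
rewrite /presented_g g_to_l_g rmorphB /= linearZ /= rmorph1 subrK scalerA.
by rewrite mulVf // scale1r.
Qed.

Lemma YTL_rel_presented x y :
  YTL_rel u d (presented_proj \o g_) presented_t x y -> x = y.
Proof.
have projl i : presented_proj (g_ i) = (presented_proj \o g_) i by [].
have projt j : presented_proj (t_ j) = presented_t j by [].
apply: (iffRL (YTL_rel_image u d projl projt)) => {}x {}y.
exact: quot_proj_relator.
Qed.

Lemma presented_YH_relator z :
  relators (YH_rel u d g_ t_) z -> (presented_proj \o g_to_l) z = 0.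
Proof.
move=> [x [y [xy ->]]]; rewrite rmorphB; apply/eqP; rewrite subr_eq0; apply/eqP.
have projg i : (presented_proj \o g_to_l) (g_ i) = presented_g i by [].
have projt j : (presented_proj \o g_to_l) (t_ j) = presented_t j.
  by rewrite /= g_to_l_t.
apply: (iffLR (YH_rel_image u d projg projt)) xy.
exact: YH_rel_of_YTL presented_lE YTL_rel_presented.
Qed.

(** The morphism [g_i |-> (u + 1) l_i - 1], which exists because the new relations
imply those of the Yokonuma--Hecke algebra. *)
Definition YH_to_presented :
    {rmorphism YokonumaHecke u d n -> quot_alg presented_gens} :=
  quot_character_rmorphism (S := YH_gens u d n) presented_YH_relator.

Lemma YH_to_presentedE p :
  YH_to_presented (quot_proj (YH_gens u d n) p) = presented_proj (g_to_l p).
Proof. exact: (quot_characterE (S := YH_gens u d n) presented_YH_relator). Qed.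

Lemma YH_to_presented_YTL_set x : YTL_set x -> YH_to_presented x = 0.
Proof.
move=> [i [j [ij ->]]]; rewrite -rmorph_braid_sum YH_to_presentedE.
rewrite !rmorph_braid_sum.
exact: braid_sum_of_YTL presented_lE YTL_rel_presented _ _ ij.
Qed.

(** If [p] is killed in the Yokonuma--Temperley--Lieb algebra, then [l_to_g p] is
killed there too; mapping it on to the presented algebra gives
[g_to_l (l_to_g p) = p], whose class must therefore vanish. *)
Lemma eval_YTL_gen_eq0 p :
  eval_free YTL_gen p = 0 <-> two_sided_ideal (relators (YTL_rel u d g_ t_)) p.
Proof.
split; last exact: (character_ideal (chi := eval_free YTL_gen))
  eval_YTL_gen_relator _.
rewrite eval_YTL_genE -(rmorph0 (quot_proj (YTL_gens u d n))) => /quot_projP.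
rewrite subr0 => /(character_ideal YH_to_presented_YTL_set).
rewrite YH_to_presentedE l_to_gK -(rmorph0 presented_proj) => /quot_projP.
by rewrite subr0.
Qed.

End Presentation.

Lemma YTL_presented (K : fieldType) (u : K) (d n : nat) :
  u + 1 != 0 ->
  presented_by (@YTL_gen K u d n) (YTL_rel u d (@letter_g K n) (@letter_t K n)).
Proof.
move=> u1_neq0.
pose g_to_l : {lrmorphism free_alg K (letter n) -> free_alg K (letter n)} :=
  eval_free (fun x : letter n =>
    match x with
    | inl i => (u + 1) *: letter_g K i - 1 | inr j => letter_t K j end).
pose l_to_g : {lrmorphism free_alg K (letter n) -> free_alg K (letter n)} :=
  eval_free (fun x : letter n =>
    match x with
    | inl i => (u + 1)^-1 *: (letter_g K i + 1) | inr j => letter_t K j end).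
have g_to_l_g i : g_to_l (letter_g K i) = (u + 1) *: letter_g K i - 1.
  exact: eval_free_gen.
have g_to_l_t j : g_to_l (letter_t K j) = letter_t K j by exact: eval_free_gen.
have l_to_g_g i : l_to_g (letter_g K i) = (u + 1)^-1 *: (letter_g K i + 1).
  exact: eval_free_gen.
have l_to_g_t j : l_to_g (letter_t K j) = letter_t K j by exact: eval_free_gen.
split=> [y|p].
  exact (eval_YTL_gen_surj u1_neq0 g_to_l_g g_to_l_t l_to_g_g l_to_g_t y).
exact (eval_YTL_gen_eq0 u1_neq0 d g_to_l_g g_to_l_t l_to_g_g l_to_g_t p).
Qed.

Lemma ratvar_add1_neq0 (R : realType) : ratvar R + 1 != 0.
Proof.
by rewrite -tofrac1 -tofracD tofrac_eq0 -size_poly_eq0 size_XaddC.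
Qed.

Theorem proposition2 (R : realType) (d n : nat) (d_ge1 : (1 <= d)%N)
    (n_ge3 : (3 <= n)%N) :
  presented_by (@YTL_gen (ratfun R) (ratvar R) d n)
    (YTL_rel (ratvar R) d (@letter_g (ratfun R) n) (@letter_t (ratfun R) n)).
Proof.
exact/YTL_presented/ratvar_add1_neq0.
Qed.
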